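(* Let $V,W$ be monotone sequential cascades. If $\varphi:\operatorname{ext}V\to\operatorname{ext}W$ is continuous, then there exist a full subcascade $U$ of $V$ and a continuous map $f:U\to W$ such that $f|_{\operatorname{ext}U}=\varphi|_{\operatorname{ext}U}$.
   Context: A cascade $(V,\sqsubset)$ is a tree with a least element $\varnothing_V$ in which every nonempty subset has a maximal element; $\max V$ is its set of maximal elements, and $V^+(v)$ is the set of immediate successors of $v\in V$. A cascade is sequential if $V^+(v)$ is countably infinite for every $v\in V\setminus\max V$. The rank $r_V(v)$ is $0$ if $v\in\max V$, and otherwise the least ordinal greater than the ranks of all the successors of $v$. A sequential cascade $V$ is monotone if for each $v\in V\setminus\max V$ the set $V^+(v)$ admits an ordering of type $\omega$ for which $r_V$ is non-decreasing. A full subcascade of $V$ is a subset $U\subset V$ with $\varnothing_V\in U$, closed downwards (if $v\sqsubset s\in U$ then $v\in U$), and such that $U\cap V^+(v)$ is infinite for each $v\in U\setminus\max V$, with the induced order; then $\varnothing_U=\varnothing_V$ and $\max U\subset\max V$. The standard topology on a sequential cascade $V$ is the finest topology in which, for each $v\in V\setminus\max V$, the cofinite filter of $V^+(v)$ converges to $v$; equivalently, $O\subset V$ is open iff $V^+(v)\setminus O$ is finite for each $v\in O\setminus\max V$. All cascades carry their standard topologies; $\operatorname{ext}V:=\{\varnothing_V\}\cup\max V$ carries the subspace topology. *)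

(* Defs.v *)
From HB Require Import structures.
From mathcomp Require Import all_boot.
From mathcomp Require Import all_classical.
From mathcomp Require Import topology.

Set Implicit Arguments.
Unset Strict Implicit.
Unset Printing Implicit Defensive.

Local Open Scope classical_set_scope.

(* [OrdSup f] is the least ordinal strictly greater than every [f i].
   Distinct terms may denote the same ordinal: equality of ordinals is
   [ord_le] in both directions.  [ord_le] and [ord_lt] form a total well-founded
   order, see [ord_le_trans], [ord_leNgt], [ord_le_total], [ord_lt_wf]. *)
Inductive ord : Type := OrdSup (A : Type) (f : A -> ord).

Fixpoint ord_le (a b : ord) : Prop :=
  let: OrdSup A f := a in
  forall i : A, let: OrdSup B g := b in exists j : B, ord_le (f i) (g j).

Definition ord_lt (a b : ord) : Prop :=
  let: OrdSup B g := b in exists j : B, ord_le a (g j).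

Lemma ord_leE A (f : A -> ord) b :
  ord_le (OrdSup f) b <-> forall i, ord_lt (f i) b.
Proof. by case: b. Qed.

Lemma ord_le_refl a : ord_le a a.
Proof. by elim: a => A f IH /= i; exists i. Qed.

Lemma ord_le_trans b a c : ord_le a b -> ord_le b c -> ord_le a c.
Proof.
elim: a b c => A f IH [B g] [C h] /= ab bc i.
have [j fg] := ab i; have [k gh] := bc j.
by exists k; exact: IH fg gh.
Qed.

Lemma ord_le_lt_trans b a c : ord_le a b -> ord_lt b c -> ord_lt a c.
Proof. by case: c => C h ab [k bk]; exists k; exact: ord_le_trans ab bk. Qed.

Lemma ord_lt_le_trans b a c : ord_lt a b -> ord_le b c -> ord_lt a c.
Proof.
case: b => B g [j aj] /ord_leE /(_ j).
exact: ord_le_lt_trans.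
Qed.

Lemma ord_ltW a b : ord_lt a b -> ord_le a b.
Proof.
elim: a b => A f IH [B g] [j fg]; apply/ord_leE => i; exists j.
by apply: ord_le_trans fg; apply: IH; exists i; exact: ord_le_refl.
Qed.

Lemma ord_lt_irrefl a : ~ ord_lt a a.
Proof.
elim: a => A f IH [i fi]; apply: (IH i).
by move/ord_leE: fi; apply.
Qed.

Lemma ord_leNgt a b : ord_le a b <-> ~ ord_lt b a.
Proof.
split=> [ab ba|]; first exact: ord_lt_irrefl (ord_lt_le_trans ba ab).
elim: a b => A f IH b nba; apply/ord_leE => i.
apply: contrapT => nfb; apply: nba; exists i.
case: b nfb => B g nfb; apply/ord_leE => j.
apply: contrapT => ngf; apply: nfb; exists j.
exact: IH.
Qed.

Lemma ord_le_total a b : ord_le a b \/ ord_le b a.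
Proof.
have [|/ord_leNgt ab] := pselect (ord_lt b a); last by left.
by move/ord_ltW; right.
Qed.

Lemma ord_lt_wf : well_founded ord_lt.
Proof.
suff H a : forall b, ord_le b a -> Acc ord_lt b.
  by move=> a; exact: H (ord_le_refl a).
elim: a => A f IH b ba; constructor => c /ord_lt_le_trans /(_ ba) [i].
exact: IH.
Qed.

(* In a tree the strict predecessors of each element form a well-ordered set. *)
Record cascade : Type := Cascade {
  cascade_car :> Type;
  cle : cascade_car -> cascade_car -> Prop;
  croot : cascade_car;
  cle_refl : forall v, cle v v;
  cle_anti : forall v w, cle v w -> cle w v -> v = w;
  cle_trans : forall w v u, cle v w -> cle w u -> cle v u;
  croot_le : forall v, cle croot v;
  cpred_wo : forall v (A : set cascade_car),
    A `<=` [set u | cle u v /\ u <> v] -> A !=set0 ->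
    exists2 a, A a & forall b, A b -> cle a b;
  cexists_max : forall A : set cascade_car, A !=set0 ->
    exists2 a, A a & forall b, A b -> cle a b -> b = a }.

Arguments cle {V} : rename.
Arguments croot V : rename.

Definition clt {V : cascade} (v w : V) : Prop := cle v w /\ v <> w.

Definition cmax (V : cascade) : set V :=
  [set v | forall w : V, cle v w -> w = v].

Definition csucc (V : cascade) (v : V) : set V :=
  [set w | clt v w /\ forall u : V, ~ (clt v u /\ clt u w)].

Definition cext (V : cascade) : set V := [set croot V] `|` @cmax V.
Arguments cext V : clear implicits.

Definition sequential (V : cascade) : Prop :=
  forall v : V, ~ cmax v -> (csucc v #= [set: nat])%card.

Lemma cgt_wf (V : cascade) : well_founded (fun w v : V => clt v w).
Proof.
move=> v; apply: contrapT => nv.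
have [a na amax] := @cexists_max V [set w | ~ Acc (fun w v : V => clt v w) w]
  (ex_intro _ v nv).
apply: na; constructor => w [aw naw]; apply: contrapT => nw.
by apply: naw; rewrite (amax _ nw aw).
Qed.

Definition crank (V : cascade) : V -> ord :=
  Fix (@cgt_wf V) (fun=> ord)
    (fun v rk => OrdSup (fun w : {w : V | clt v w} => rk (sval w) (svalP w))).

Lemma crankE (V : cascade) (v : V) :
  crank v = OrdSup (fun w : {w : V | clt v w} => crank (sval w)).
Proof.
rewrite /crank Fix_eq // => x f g fg; congr OrdSup.
by apply/funext => w; exact: fg.
Qed.

Lemma crank_max (V : cascade) (v : V) : cmax v -> forall a, ord_le (crank v) a.
Proof. by move=> mv a; rewrite crankE => -[w [/= /mv -> []]]. Qed.

Lemma crank_gt (V : cascade) (v w : V) :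
  clt v w -> ord_lt (crank w) (crank v).
Proof.
move=> vw; rewrite (crankE v).
by exists (exist _ w vw) => /=; exact: ord_le_refl.
Qed.

Lemma crank_least (V : cascade) (v : V) a :
  (forall w, clt v w -> ord_lt (crank w) a) -> ord_le (crank v) a.
Proof. by move=> H; rewrite crankE; apply/ord_leE => -[w vw]; exact: H. Qed.

(* An ordering of type omega of [csucc v] is a bijective enumeration by [nat]. *)
Definition monotone_cascade (V : cascade) : Prop :=
  forall v : V, ~ cmax v ->
    exists2 e : nat -> V, set_bij [set: nat] (csucc v) e
      & forall i j : nat, (i <= j)%N -> ord_le (crank (e i)) (crank (e j)).

Definition std_open (V : cascade) : set_system V :=
  [set O : set V | forall v, O v -> ~ cmax v -> finite_set (csucc v `\` O)].

Lemma std_openT (V : cascade) : @std_open V setT.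
Proof. by move=> v _ _; rewrite setDT; exact: finite_set0. Qed.

Lemma std_openI (V : cascade) : setI_closed (@std_open V).
Proof.
move=> A B oA oB v [Av Bv] nv; rewrite setDIr finite_setU; split.
  exact: oA.
exact: oB.
Qed.

Lemma std_open_bigU (V : cascade) (I : Type) (f : I -> set V) :
  (forall i, std_open (f i)) -> std_open (\bigcup_i f i).
Proof.
move=> of_ v [i _ fv] nv; apply: sub_finite_set (of_ i v fv nv).
by move=> w [vw nw]; split=> // fw; apply: nw; exists i.
Qed.

HB.instance Definition _ (V : cascade) := gen_eqMixin (cascade_car V).
HB.instance Definition _ (V : cascade) := gen_choiceMixin (cascade_car V).
HB.instance Definition _ (V : cascade) :=
  isOpenTopological.Build (cascade_car V)
    (@std_openT V) (@std_openI V) (@std_open_bigU V).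

Lemma std_openE (V : cascade) (O : set V) : open O <-> std_open O.
Proof. by []. Qed.

Definition full_subcascade (V : cascade) (U : set V) : Prop :=
  [/\ U (croot V),
      forall v s : V, U s -> clt v s -> U v
    & forall v : V, U v -> ~ cmax v -> infinite_set (U `&` csucc v)].

Section Subcascade.
Variables (V : cascade) (U : set V) (HU : full_subcascade U).

Let car : Type := set_type U.
Let le (x y : car) : Prop := cle (val x) (val y).
Let root : car := SigSub (mem_set (let: And3 h _ _ := HU in h)).

Let le_refl x : le x x. Proof. exact: cle_refl. Qed.

Let le_anti x y : le x y -> le y x -> x = y.
Proof. by move=> xy yx; apply/val_inj; exact: cle_anti xy yx. Qed.

Let le_trans y x z : le x y -> le y z -> le x z.
Proof. exact: cle_trans. Qed.

Let root_le x : le root x. Proof. exact: croot_le. Qed.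

Let pred_wo v (A : set car) :
  A `<=` [set u | le u v /\ u <> v] -> A !=set0 ->
  exists2 a, A a & forall b, A b -> le a b.
Proof.
move=> Av [a0 Aa0].
have [||_ [a Aa <-] amin] := @cpred_wo V (val v) [set val a | a in A].
- move=> _ [a /Av[av nav] <-]; split=> // eav; apply: nav.
  exact: val_inj.
- by exists (val a0), a0.
- by exists a => // b Ab; apply: amin; exists b.
Qed.

Let exists_max (A : set car) : A !=set0 ->
  exists2 a, A a & forall b, A b -> le a b -> b = a.
Proof.
move=> [a0 Aa0].
have [|_ [a Aa <-] amax] := @cexists_max V [set val a | a in A].
- by exists (val a0), a0.
- by exists a => // b Ab ab; apply/val_inj/amax => //; exists b.
Qed.

Definition subcascade : cascade :=
  @Cascade car le root le_refl le_anti le_trans root_le pred_wo exists_max.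

Definition subcascade_val (x : subcascade) : V := set_val (x : set_type U).

Lemma cext_subcascade (x : subcascade) :
  cext subcascade x -> cext V (subcascade_val x).
Proof.
move=> [->|mx]; [by left | right].
apply: contrapT => nmx; case: HU => _ _ /(_ _ (set_valP x) nmx).
apply; suff -> : U `&` csucc (subcascade_val x) = set0 by exact: finite_set0.
rewrite -subset0 => w [Uw [[xw nxw] _]]; apply: nxw.
by rewrite -(mx (SigSub (mem_set Uw)) xw).
Qed.

Definition cext_incl (x : set_type (cext subcascade)) : set_type (cext V) :=
  SigSub (mem_set (cext_subcascade (set_valP x))).

End Subcascade.

(* Main.v *)
(** Let [A] be a set of maximal elements and say that [g] converges to [t] along
    [A] at [v] when [v] is in the closure of [A] and [g] maps the trace on [A] of
    the neighbourhoods of [v] to a filter converging to [t].  In that case,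
    infinitely many successors [w] of [v] are in the closure of [A], and for
    infinitely many of them one of the following happens:
    - [w] is in the closure of [A `&` g @^-1` [set t]]; send [w] to [t];
    - [w] is in the closure of the set of [x] in [A] with [g x] above some
      successor [k] of [t]; send [w] to [k].  Each [k] occurs finitely often;
    - neither; send [w] to [t].
    In each case [g] converges along the smaller set at [w] to the chosen
    value for almost all these [w]: otherwise a diagonal intersection of
    neighbourhoods witnessing the failures would be a neighbourhood of [t]
    contradicting convergence at [v].  Recursion on [v] yields [U] and [f]. *)
Require Import Defs.
From mathcomp Require Import all_boot.
From mathcomp Require Import all_classical.
From mathcomp Require Import topology.

Set Implicit Arguments.
Unset Strict Implicit.

Local Open Scope classical_set_scope.

(** * Order and closures in a cascade *)

Section Tree.
Context {V : cascade}.
Implicit Types x y z v : V.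

Lemma clt_le_trans x y z : clt x y -> cle y z -> clt x z.
Proof.
move=> [xy nxy] yz; split; first exact: cle_trans xy yz.
by move=> exz; apply: nxy; apply: cle_anti => //; rewrite exz.
Qed.

Lemma clt_nle x y : clt x y -> ~ cle y x.
Proof. by move=> [xy nxy] yx; apply: nxy; exact: cle_anti. Qed.

Lemma cle_total_below z x y : cle x z -> cle y z -> cle x y \/ cle y x.
Proof.
move=> xz yz.
have [->|nxz] := pselect (x = z); first by right.
have [->|nyz] := pselect (y = z); first by left.
have [||a [->|->] amin] := @cpred_wo V z [set x; y].
- by move=> _ [->|->].
- by exists x; left.
- by left; apply: amin; right.
- by right; apply: amin; left.
Qed.

Lemma csucc_below x y : clt x y -> exists2 k, csucc x k & cle k y.
Proof.
move=> xy.
have [[a0 a0P]|nE] := pselect ([set u | clt x u /\ clt u y] !=set0).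
  have [||a [xa ay] amin] := @cpred_wo V y [set u | clt x u /\ clt u y].
  - by move=> u [_ [uy nuy]].
  - by exists a0.
  exists a; last by case: ay.
  split=> // u [xu ua]; apply: (clt_nle ua); apply: amin; split=> //.
  by apply: (clt_le_trans ua); case: ay.
exists y; last exact: cle_refl.
by split=> // u uP; apply: nE; exists u.
Qed.

Lemma csucc_cle x y z : csucc x y -> cle z y -> z <> y -> cle z x.
Proof.
move=> [[xy nxy] imm] zy nzy.
have [//|xz] := @cle_total_below y z x zy xy.
have [->|nxz] := pselect (x = z); first exact: cle_refl.
by case: (imm z).
Qed.

Lemma csucc_uniq x y k l : csucc x k -> csucc x l -> cle k y -> cle l y -> k = l.
Proof.
move=> xk xl ky ly.
wlog kl : k l xk xl ky ly / cle k l.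
  move=> H; have [|] := cle_total_below ky ly; first exact: H.
  by move=> lk; apply/esym/H.
apply: contrapT => nkl; case: xl => _ /(_ k); apply; split=> //.
by case: xk.
Qed.

Lemma nmax_clt x y : clt x y -> ~ cmax x.
Proof. by move=> [xy nxy] /(_ y xy) /esym. Qed.

Lemma csucc_nmax x y : csucc x y -> ~ cmax x.
Proof. by case=> /nmax_clt. Qed.

Lemma std_closureP (A : set V) v :
  closure A v <-> forall O : set V, open O -> O v -> A `&` O !=set0.
Proof.
split=> [cA O oO Ov|H O]; first by apply: cA; exact: open_nbhs_nbhs.
rewrite nbhsE => -[O' [oO' O'v] sub].
by have [x [Ax /sub Ox]] := H _ oO' O'v; exists x.
Qed.

Lemma open_setC1 x : open (~` [set x]).
Proof.
apply/std_openE => y _ _; apply: (@sub_finite_set _ _ [set x]) => //.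
by move=> z [_ /contrapT].
Qed.

Lemma open_above x : open [set y | cle x y].
Proof.
apply/std_openE => y xy _; rewrite [X in finite_set X](_ : _ = set0) //.
rewrite -subset0 => z [[[yz _] _]]; apply; exact: cle_trans xy yz.
Qed.

Lemma open_nabove x : open [set y | ~ cle x y].
Proof.
apply/std_openE => y nxy _; apply: (@sub_finite_set _ _ [set x]) => //.
move=> z [yz /contrapT xz]; apply: contrapT => nzx; apply: nxy.
by apply: csucc_cle yz xz _ => /esym.
Qed.

Lemma open_max v : cmax v -> open [set v].
Proof. by move=> mv; apply/std_openE => _ ->. Qed.

Lemma closure_max (A : set V) v : cmax v -> closure A v -> A v.
Proof.
by move=> /open_max ov /std_closureP /(_ _ ov erefl) [x [Ax <-]].
Qed.

Lemma closure_of_csucc (A : set V) v : ~ cmax v ->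
  infinite_set (csucc v `&` closure A) -> closure A v.
Proof.
move=> nv inf; apply/std_closureP => O oO Ov.
have [w [[vw cw] nO]] := infinite_setN0 (infinite_setD inf (oO v Ov nv)).
move/std_closureP: cw; apply=> //.
by apply: contrapT => nOw; apply: nO.
Qed.

(** If only finitely many successors of [v] were in the closure of [A], adding [v] to the complement
    of that closure would give a neighbourhood of [v] disjoint from [A]. *)
Lemma closure_csucc (A : set V) v : A `<=` @cmax V -> ~ cmax v ->
  closure A v -> infinite_set (csucc v `&` closure A).
Proof.
move=> Am nv /std_closureP cA fin.
have oO : open (~` closure A `|` [set v]).
  apply/std_openE => x [ncx nx|-> _].
    have /std_openE /(_ x ncx nx) := closed_openC (@closed_closure _ A).
    by apply: sub_finite_set => y [xy nc]; split=> // c; apply: nc; left.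
  apply: sub_finite_set fin => y [vy nc]; split=> //.
  by apply: contrapT => c; apply: nc; left.
have [x [Ax [ncx|xv]]] := cA _ oO (or_intror erefl).
  by apply: ncx; exact: subset_closure.
by apply: nv; rewrite -xv; exact: Am.
Qed.

Lemma closure_bigcup (I : choiceType) (D : set I) (F : I -> set V) v :
  finite_set D -> closure (\bigcup_(i in D) F i) v ->
  exists2 i, D i & closure (F i) v.
Proof.
move=> fD /std_closureP c; apply: contrapT => H.
have : open (~` \bigcup_(i in D) closure (F i)).
  by apply/closed_openC/closed_bigcup => // i _; exact: closed_closure.
move=> /c [|x [[i Di Fx]]]; first by move=> [i Di ci]; apply: H; exists i.
by apply; exists i => //; exact: subset_closure.
Qed.

Lemma closure_cmax (seqV : sequential V) v : closure (@cmax V) v.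
Proof.
elim: (cgt_wf v) => {}v _ IH.
have [mv|nv] := pselect (cmax v); first exact: subset_closure.
apply: closure_of_csucc => //; apply: sub_infinite_set (_ : infinite_set (csucc v)).
  by move=> w vw; split=> //; apply: IH; case: vw.
by apply/infiniteP; have := seqV v nv; rewrite card_eq_le => /andP[].
Qed.

Lemma csucc_enum (seqV : sequential V) v :
  exists e : V -> nat, {in csucc v &, injective e}.
Proof.
have [mv|nv] := pselect (cmax v).
  by exists (fun=> 0) => x y /set_mem /csucc_nmax.
by apply/countable_injP; have := seqV v nv; rewrite card_eq_le => /andP[].
Qed.

End Tree.

(** * Diagonal intersections of neighbourhoods *)

Lemma finite_inj_preimage {T U : Type} (A : set T) (B : set U) (f : T -> U) :
  {in A &, injective f} -> finite_set B -> finite_set (A `&` f @^-1` B).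
Proof.
move=> finj fB.
have /inj_card_eq/eq_finite_set <- : {in A `&` f @^-1` B &, injective f}.
  by move=> x y /set_mem[Ax _] /set_mem[Ay _]; apply: finj; exact: mem_set.
by apply: sub_finite_set fB => _ [x [_ Bx] <-].
Qed.

(* The diagonal intersection of the neighbourhoods [P w] is still a
   neighbourhood of [t]: above each successor [k] of [t] only finitely many of
   them are imposed. *)
Lemma open_diagonal (W : cascade) (I : Type) (t : W) (D : set I)
    (E : I -> W -> Prop) (P : I -> set W) :
  (forall w, open (P w)) ->
  (forall k, csucc t k -> finite_set (D `&` E^~ k)) ->
  (forall w k, E w k -> P w k) ->
  open [set y | cle t y /\
    forall w k, D w -> csucc t k -> cle k y -> E w k -> P w y].
Proof.
move=> oP finE EP; apply/std_openE => y [ty Qy] ny.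
(* [F] collects the indices whose constraint is active at [y]; it is finite because at most one
   successor of [t] lies below [y]. *)
set F := [set w | D w /\ exists k, [/\ csucc t k, cle k y, E w k & P w y]].
have finF : finite_set F.
  have [[k tk ky]|nk] := pselect (exists2 k, csucc t k & cle k y).
    apply: sub_finite_set (finE k tk) => w [Dw [l [tl ly El _]]]; split=> //.
    by rewrite /= (csucc_uniq tk tl ky ly).
  rewrite [F](_ : _ = set0) // -subset0 => w [Dw [l [tl ly _ _]]].
  by apply: nk; exists l.
apply: (@sub_finite_set _ _ (\bigcup_(w in F) (csucc y `\` P w))).
  move=> z [yz nQz]; have cyz : cle y z by case: yz => -[].
  have [[w [k [Dw tk kz Ewk nPz]]]|H] := pselect (exists w k,
      [/\ D w, csucc t k, cle k z, E w k & ~ P w z]); last first.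
    case: nQz; split; first exact: cle_trans ty cyz.
    by move=> w k Dw tk kz Ewk; apply: contrapT => nP; apply: H; exists w, k.
  (* As [P w] contains [k] but not [z], the constraint violated at [z] was already active at [y]. *)
  have nkz : k <> z by move=> ekz; apply: nPz; rewrite -ekz; exact: EP.
  have ky := csucc_cle yz kz nkz.
  by exists w => //; split=> //; exists k; split=> //; exact: Qy Ewk.
apply: bigcup_finite => // w [_ [k [_ _ _ Py]]].
by have /std_openE := oP w; apply.
Qed.

(** * Convergence along a set, and one step from [v] to its successors *)

Section Extension.
Context {V W : cascade}.
Hypotheses (seqV : sequential V) (seqW : sequential W).
Variable g : V -> W.
Implicit Types (A B : set V) (v w : V) (t k : W).

(* [g] maps the trace on [A] of the neighbourhood filter of [v] to a filter
   converging to [t]. *)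
Definition conv_along A v t := closure A v /\
  forall P : set W, open P -> P t -> ~ closure (A `\` g @^-1` P) v.

Lemma conv_along_cst A v t : closure (A `&` g @^-1` [set t]) v ->
  conv_along (A `&` g @^-1` [set t]) v t.
Proof.
move=> c; split=> // P _ Pt; rewrite [X in closure X](_ : _ = set0).
  by rewrite closure0.
by rewrite -subset0 => x [[_ /= ->]].
Qed.

Section Step.
Variables (A : set V) (v : V) (t : W).
Hypotheses (Am : A `<=` @cmax V) (nv : ~ cmax v) (cAv : conv_along A v t).

(** Otherwise [v] itself would be in the closure of the points of [A] that [g] sends outside [P]. *)
Let conv_along_csucc P : open P -> P t ->
  finite_set (csucc v `&` closure (A `\` g @^-1` P)).
Proof.
move=> oP Pt; apply: contrapT => inf; case: cAv => _ /(_ P oP Pt); apply.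
exact: closure_of_csucc.
Qed.

Let above k := A `&` g @^-1` [set y | cle k y].

Let above_finite k : csucc t k -> finite_set (csucc v `&` closure (above k)).
Proof.
move=> tk; apply: sub_finite_set (conv_along_csucc (@open_nabove W k) _).
  move=> w [vw c]; split=> //; apply: closure_subset c => x [Ax kx].
  by split=> //; apply.
by apply: clt_nle; case: tk.
Qed.

Let diagonal_finite (D : set V) (E : V -> W -> Prop) (P : V -> set W) :
  (forall w, open (P w)) ->
  (forall k, csucc t k -> finite_set (D `&` E^~ k)) ->
  (forall w k, E w k -> P w k) ->
  finite_set (csucc v `&` closure (A `\` g @^-1` [set y | cle t y /\
    forall w k, D w -> csucc t k -> cle k y -> E w k -> P w y])).
Proof.
move=> oP finE EP; apply: conv_along_csucc; first exact: open_diagonal.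
split; first exact: cle_refl.
move=> w k _ [/clt_nle tk _] kt; by case: tk.
Qed.

Let step_above (s : V -> W) (N : set V) :
  (forall w, N w -> [/\ csucc v w, csucc t (s w) & closure (above (s w)) w]) ->
  finite_set (N `&` [set w | ~ conv_along (above (s w)) w (s w)]).
Proof.
move=> HN; apply: contrapT => infD.
set D := N `&` _ in infD.
have /choice[P HP] : forall w, exists P : set W,
    [/\ open P, D w -> P (s w) & D w -> closure (above (s w) `\` g @^-1` P) w].
  move=> w; have [Dw|nDw] := pselect (D w); last first.
    by exists setT; split=> //; exact: openT.
  case: (Dw) => Nw nc; apply: contrapT => H; apply: nc.
  split; first by have [] := HN w Nw.
  by move=> P oP Ps c; apply: H; exists P.
(* The neighbourhood of [s w] is imposed above [s w] only; by [above_finite], finitely many [w]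
   share a value [k]. *)
have finE k : csucc t k -> finite_set (D `&` [set w | D w /\ k = s w]).
  move=> tk; apply: sub_finite_set (above_finite tk) => w [[Nw _] [_ ->]].
  by have [] := HN w Nw.
have EP w k : D w /\ k = s w -> P w k.
  by case=> Dw ->; have [_ + _] := HP w; apply.
have fin := diagonal_finite (fun w => let: And3 h _ _ := HP w in h) finE EP.
have [w [Dw nc]] := infinite_setN0 (infinite_setD infD fin).
have [vw tsw _] := HN w Dw.1; apply: nc; split=> //.
have [_ _ /(_ Dw)] := HP w; apply: closure_subset => x [[Ax sx] nPx].
by split=> // -[_ /(_ w (s w))] H; apply: nPx; exact: H.
Qed.

Let step_root (N : set V) :
  (forall w, N w -> [/\ csucc v w, closure A w,
     ~ closure (A `&` g @^-1` [set t]) w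
   & forall k, csucc t k -> ~ closure (above k) w]) ->
  finite_set (N `&` [set w | ~ conv_along A w t]).
Proof.
move=> HN; apply: contrapT => infD.
set D := N `&` _ in infD.
have /choice[P HP] : forall w, exists P : set W,
    [/\ open P, D w -> P t & D w -> closure (A `\` g @^-1` P) w].
  move=> w; have [Dw|nDw] := pselect (D w); last first.
    by exists setT; split=> //; exact: openT.
  case: (Dw) => Nw nc; apply: contrapT => H; apply: nc.
  split; first by have [] := HN w Nw.
  by move=> P oP Ps c; apply: H; exists P.
have [eV eVinj] := csucc_enum seqV v.
have [eW eWinj] := csucc_enum seqW t.
(* Now [P w] is a neighbourhood of [t], and imposing it above every successor would break the
   finiteness needed for a diagonal intersection. Comparing enumerations leaves finitely many [w]
   for each [k], yet omits only finitely many [k] for each [w]. *)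
pose E w k := (eV w <= eW k)%N /\ P w k.
have finE k : csucc t k -> finite_set (D `&` E^~ k).
  move=> tk; apply: (@sub_finite_set _ _ (csucc v `&` eV @^-1` `I_(eW k).+1)).
    by move=> w [[Nw _] [/= le _]]; split; first by have [] := HN w Nw.
  by apply: finite_inj_preimage => //; exact: finite_II.
have EP w k : E w k -> P w k by case.
have fin := diagonal_finite (fun w => let: And3 h _ _ := HP w in h) finE EP.
have fin2 := conv_along_csucc (@open_above W t) (cle_refl t).
have [w [[Dw nc] nc2]] :=
  infinite_setN0 (infinite_setD (infinite_setD infD fin) fin2).
have [vw cAw nct nck] := HN w Dw.1.
have [oP /(_ Dw) Pt /(_ Dw) cP] := HP w.
set Q := (X in g @^-1` X) in fin nc.
have finF : finite_set (csucc t `\` E w).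
  have [mt|nt] := pselect (cmax t).
    rewrite (_ : _ `\` _ = set0) // -subset0 => k [/csucc_nmax]; exact.
  apply: (@sub_finite_set _ _ ((csucc t `&` eW @^-1` `I_(eV w)) `|` (csucc t `\` P w))).
    move=> k [tk nE]; have [le|lt] := leqP (eV w) (eW k); last by left.
    by right; split=> // Pk; apply: nE.
  rewrite finite_setU; split; last by have /std_openE := oP; apply.
  by apply: finite_inj_preimage => //; exact: finite_II.
(* A point of [A] sent outside [P w] is sent outside [Q], or not above [t], or to [t], or above one
   of the finitely many successors where [P w] is not imposed. None of these four pieces has [w] in
   its closure. *)
have : closure ((A `\` g @^-1` Q) `|` ((A `\` g @^-1` [set y | cle t y]) `|`
   ((A `&` g @^-1` [set t]) `|` \bigcup_(k in csucc t `\` E w) above k))) w.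
  apply: closure_subset cP => x [Ax nPx].
  have [Qx|nQx] := pselect (Q (g x)); last by left.
  have [tx|ntx] := pselect (cle t (g x)); last by right; left.
  have [etx|netx] := pselect (t = g x); first by right; right; left.
  have [k tk kx] := csucc_below (conj tx netx).
  right; right; right; exists k => //; split=> // Ek.
  by apply: nPx; case: Qx => _ /(_ w k); exact.
rewrite !closureU => -[|[|[//|]]].
- by move=> c; apply: nc.
- by move=> c; apply: nc2.
- by case/closure_bigcup => // k [tk _]; exact: nck.
Qed.

(** [N] is the set of successors of [v] to keep, [s] gives their values, and the recursion continues
    at [w] along [B w]. The last clause will be continuity at [v]. *)
Lemma conv_along_step : exists (N : set V) (s : V -> W) (B : V -> set V),
  [/\ N `<=` csucc v, infinite_set N,
      forall w, B w `<=` A /\ (N w -> conv_along (B w) w (s w))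
    & forall P : set W, open P -> P t -> finite_set (N `\` s @^-1` P)].
Proof.
have infA := closure_csucc Am nv cAv.1.
pose Na := csucc v `&` closure (A `&` g @^-1` [set t]).
have [fina|infa] := pselect (finite_set Na); last first.
  exists Na, (fun=> t), (fun=> A `&` g @^-1` [set t]); split=> //.
  - exact: subIsetl.
  - move=> w; split; first exact: subIsetl.
    by move=> [_ c]; exact: conv_along_cst.
  - by move=> P _ Pt; rewrite (_ : _ `\` _ = set0) // -subset0 => w [_]; apply.
pose Nb := csucc v `&` [set w | exists2 k, csucc t k & closure (above k) w].
have [finb|infb] := pselect (finite_set Nb); last first.
  have /choice[s Hs] : forall w, exists k,
      Nb w -> csucc t k /\ closure (above k) w.
    move=> w; have [[_ [k tk c]]|] := pselect (Nb w); first by exists k.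
    by exists t.
  have HN w : Nb w -> [/\ csucc v w, csucc t (s w) & closure (above (s w)) w].
    by move=> Nw; have [? ?] := Hs w Nw; split=> //; case: Nw.
  exists (Nb `\` (Nb `&` [set w | ~ conv_along (above (s w)) w (s w)])), s,
    (fun w => above (s w)); split.
  - by move=> w [[]].
  - by apply: infinite_setD => //; exact: step_above.
  - move=> w; split; first exact: subIsetl.
    by move=> [Nw nc]; apply: contrapT => c; apply: nc.
  - move=> P oP Pt.
    (* Only finitely many successors of [t] are outside [P], and each is the value of finitely many
       [w]. *)
    apply: (@sub_finite_set _ _ (\bigcup_(k in csucc t `\` P)
        (csucc v `&` closure (above k)))).
      by move=> w [[/HN[vw tsw c] _] nP]; exists (s w).
    apply: bigcup_finite => [|k [tk _]]; last exact: above_finite.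
    have [mt|nt] := pselect (cmax t).
      rewrite (_ : _ `\` _ = set0) // -subset0 => k [/csucc_nmax]; exact.
    by have /std_openE := oP; apply.
pose N := ((csucc v `&` closure A) `\` Na) `\` Nb.
have infN : infinite_set N by do 2 apply: infinite_setD => //.
have HN w : N w -> [/\ csucc v w, closure A w,
     ~ closure (A `&` g @^-1` [set t]) w
   & forall k, csucc t k -> ~ closure (above k) w].
  move=> [[[vw c] na] nb]; split=> // [?|k tk ck]; first exact: na.
  by apply: nb; split=> //; exists k.
exists (N `\` (N `&` [set w | ~ conv_along A w t])), (fun=> t), (fun=> A).
split.
- by move=> w [/HN[]].
- by apply: infinite_setD => //; exact: step_root.
- by move=> w; split=> // -[Nw nc]; apply: contrapT => c; apply: nc.
- by move=> P _ Pt; rewrite (_ : _ `\` _ = set0) // -subset0 => w [_]; apply.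
Qed.

End Step.

(** * Solutions of the problem on the part of [V] above [v], by gluing and recursion *)

Definition partial_extension v t (U : set V) (f : V -> W) :=
  [/\ U v /\ f v = t,
      forall x, U x -> cle v x,
      forall x y, U y -> cle v x -> cle x y -> U x,
      forall x, U x -> cmax x -> f x = g x
    & forall x, U x -> ~ cmax x -> infinite_set (U `&` csucc x) /\
        forall P : set W, open P -> P (f x) ->
          finite_set ((U `&` csucc x) `\` f @^-1` P)].

Lemma partial_extension_max v t : cmax v -> g v = t ->
  partial_extension v t [set v] (fun=> t).
Proof.
move=> mv gv; split=> // [x ->|x y -> vx xv|x ->|x -> //].
- exact: cle_refl.
- exact: cle_anti.
- by rewrite gv.
Qed.

(** The parts of [V] above distinct successors of [v] are disjoint, so the pieces combine without
    conflict. Continuity at [v] is the hypothesis on [s]; elsewhere it is inherited. *)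
Lemma partial_extension_glue v t (N : set V) (s : V -> W)
    (U : V -> set V) (F : V -> V -> W) :
  ~ cmax v -> N `<=` csucc v -> infinite_set N ->
  (forall P : set W, open P -> P t -> finite_set (N `\` s @^-1` P)) ->
  (forall w, N w -> partial_extension w (s w) (U w) (F w)) ->
  exists U' f, partial_extension v t U' f.
Proof.
move=> nv Nv infN scvg HU.
(* [b x] is the unique successor of [v] below [x]; it is arbitrary unless [x] is strictly above
   [v]. *)
have /choice[b Hb] : forall x, exists w, clt v x -> csucc v w /\ cle w x.
  move=> x; have [vx|] := pselect (clt v x); last by exists v.
  by have [w vw wx] := csucc_below vx; exists w.
pose f x := if `[< x = v >] then t else F (b x) x.
have UvP w x : N w -> U w x -> clt v x.
  move=> Nw Ux; have [_ /(_ x Ux) wx _ _ _] := HU w Nw.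
  by apply: clt_le_trans wx; case: (Nv w Nw).
have bE w x : N w -> U w x -> b x = w.
  move=> Nw Ux; have [vbx bx] := Hb x (UvP w x Nw Ux).
  have [_ /(_ x Ux) wx _ _ _] := HU w Nw.
  exact: (csucc_uniq vbx (Nv w Nw) bx wx).
have fE w x : N w -> U w x -> f x = F w x.
  move=> Nw Ux; rewrite /f asboolF ?(bE w x)// => exv.
  by have [_ []] := UvP w x Nw Ux.
have fv : f v = t by rewrite /f asboolT.
pose U' := [set v] `|` \bigcup_(w in N) U w.
have U'v : U' `&` csucc v = N.
  apply/seteqP; split=> [x [[->|[w Nw Ux]] vx]|w Nw].
  - by case: vx => -[_ []].
  - have [_ /(_ x Ux) wx _ _ _] := HU w Nw.
    by rewrite (csucc_uniq vx (Nv w Nw) (cle_refl x) wx).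
  - by split; [right; exists w => //; have [[]] := HU w Nw|exact: Nv].
have U'w w x : N w -> U w x -> U' `&` csucc x = U w `&` csucc x.
  move=> Nw Ux; have vx := UvP w x Nw Ux.
  apply/seteqP; split=> y [Uy xy]; split=> //; last by right; exists w.
  have cxy : clt x y by case: xy.
  case: Uy => [eyv|[w' Nw' Uy]].
    by case: (clt_nle cxy); rewrite eyv; case: vx.
  have [_ /(_ x Ux) wx _ _ _] := HU w Nw.
  have [_ /(_ y Uy) wy _ _ _] := HU w' Nw'.
  have wy' : cle w y by apply: cle_trans wx _; case: cxy.
  by rewrite (csucc_uniq (Nv w Nw) (Nv w' Nw') wy' wy).
exists U', f; split.
- by split=> //; left.
- by move=> x [->|[w Nw /(UvP w x Nw)[]//]]; exact: cle_refl.
- move=> x y [->|[w Nw Uy]] vx xy; first by left; exact: cle_anti.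
  have [exv|nxv] := pselect (x = v); first by left.
  have [w' vw' w'x] := @csucc_below _ v x (conj vx (fun e => nxv (esym e))).
  have [_ /(_ y Uy) wy down _ _] := HU w Nw.
  right; exists w => //; apply: (down x y Uy _ xy).
  by rewrite -(csucc_uniq vw' (Nv w Nw) (cle_trans w'x xy) wy).
- move=> x [->//|[w Nw Ux]] mx; rewrite (fE w)//.
  by have [_ _ _ + _] := HU w Nw; exact.
- move=> x [->|[w Nw Ux]] nx.
    rewrite U'v fv; split=> // P oP Pt; apply: sub_finite_set (scvg P oP Pt).
    move=> w [Nw nP]; split=> // Psw; apply: nP.
    by have [[Uw sw] _ _ _ _] := HU w Nw; rewrite /= (fE w) // sw.
  rewrite (U'w w)// (fE w)//.
  have [_ _ _ _ /(_ x Ux nx)[inf cvg]] := HU w Nw; split=> // P oP PF.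
  apply: sub_finite_set (cvg P oP PF) => y [[Uy xy] nP]; split=> // PFy.
  by apply: nP; rewrite /= (fE w).
Qed.

Lemma partial_extension_exists A v t : A `<=` @cmax V -> conv_along A v t ->
  exists U f, partial_extension v t U f.
Proof.
elim: (cgt_wf v) A t => {}v _ IH A t Am cA.
have [mv|nv] := pselect (cmax v).
  exists [set v], (fun=> t); apply: partial_extension_max => //.
  (* Here [v] belongs to [A]; if [g v] were not [t], the complement of the point [g v] would be a
     neighbourhood of [t] contradicting convergence. *)
  apply: contrapT => ngv; case: cA => /closure_max - /(_ mv) Av.
  move=> /(_ _ (@open_setC1 W (g v)))[]; first exact: nesym.
  by apply: subset_closure; split=> //; apply.
have [N [s [B [Nv infN HB scvg]]]] := conv_along_step Am nv cA.
have /choice[UF HUF] : forall w, exists UF : set V * (V -> W),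
    N w -> partial_extension w (s w) UF.1 UF.2.
  move=> w; have [Nw|] := pselect (N w); last by exists (set0, fun=> t).
  have [BA /(_ Nw) cB] := HB w.
  have vw : clt v w by case: (Nv w Nw).
  have [U [f Uf]] := IH w vw (B w) (s w) (subset_trans BA Am) cB.
  by exists (U, f).
exact: partial_extension_glue HUF.
Qed.

End Extension.

(** * Translation to and from the subspace [ext] and the subcascade *)

Lemma conv_along_root {V W : cascade} (seqV : sequential V)
    (phi : set_type (cext V) -> set_type (cext W)) (g : V -> W)
    (r : set_type (cext V)) : continuous phi -> set_val r = croot V ->
  (forall x, g (set_val x) = set_val (phi x)) ->
  conv_along g (@cmax V) (croot V) (set_val (phi r)).
Proof.
move=> phi_cont rE gE; split; first exact: closure_cmax.
move=> P oP Pt /std_closureP c.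
have : open (phi @^-1` (set_val @^-1` P)).
  by move/continuousP: phi_cont; apply; exists P.
(* Open sets of the subspace are traces of open sets of [V]; this [O] is a neighbourhood of the root
   whose maximal elements [g] sends into [P]. *)
case=> O oO OE; have Or : O (croot V).
  by rewrite -rE -[O _]/((set_val @^-1` O) r) OE.
have [x [[mx nP] Ox]] := c O oO Or; apply: nP.
have ex : cext V x by right.
have := gE (SigSub (mem_set ex)); rewrite /= => ->.
rewrite -[P _]/((phi @^-1` (set_val @^-1` P)) _) -OE.
exact: Ox.
Qed.

(** By downward closure of [U], immediate successors in the subcascade are immediate successors in
    [V], so finiteness transfers. *)
Lemma continuous_subcascade {V W : cascade} (U : set V)
    (HU : full_subcascade U) (f : V -> W) :
  (forall x, U x -> ~ cmax x -> forall P : set W, open P -> P (f x) ->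
     finite_set ((U `&` csucc x) `\` f @^-1` P)) ->
  continuous (f \o @subcascade_val V U HU).
Proof.
move=> H; apply/continuousP => P oP; apply/std_openE => x Px nx.
have nvx : ~ cmax (subcascade_val x).
  by move=> mx; apply: nx => y xy; apply/val_inj/mx.
have fin := H _ (set_valP x) nvx P oP Px.
have inj : {in csucc x &, injective (@subcascade_val V U HU)}.
  by move=> y z _ _; exact: val_inj.
apply: sub_finite_set (finite_inj_preimage inj fin) => y [xy nP].
split=> //; split=> //; split; first exact: set_valP.
case: xy => -[xy nxy] imm; split.
  by split=> // exy; apply: nxy; exact: val_inj.
move=> u [[xu nxu] [uy nuy]].
have [_ down _] := (HU).
have Uu : U u by apply: (down _ _ (set_valP y)); split.
apply: (imm (SigSub (mem_set Uu))); split; split=> //.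
- by move=> e; apply: nxu; rewrite e.
- by move=> e; apply: nuy; rewrite /subcascade_val -e.
Qed.

Theorem theorem7p2 (V W : cascade)
    (seqV : sequential V) (monV : monotone_cascade V)
    (seqW : sequential W) (monW : monotone_cascade W)
    (phi : set_type (cext V) -> set_type (cext W))
    (phi_cont : continuous phi) :
  exists (U : set V) (HU : full_subcascade U) (f : subcascade HU -> W),
    continuous f /\
    forall x : set_type (cext (subcascade HU)),
      f (set_val x) = set_val (phi (cext_incl x)).
Proof.
(* [g] extends [phi] to all of [V]; [croot W] is a placeholder, since [gE] and the conclusion
   concern [cext V] only. *)
pose g (x : V) : W := if pselect (cext V x) is left ex
  then set_val (phi (SigSub (mem_set ex))) else croot W.
have gE (x : set_type (cext V)) : g (set_val x) = set_val (phi x).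
  rewrite /g; case: pselect => [ex|]; last by case; exact: set_valP.
  by congr (set_val (phi _)); exact: val_inj.
have r0 : cext V (croot V) by left.
have [U [f [[Ur fr] _ down fmax Hsucc]]] := partial_extension_exists seqV seqW
  (@subset_refl _ (@cmax V))
  (@conv_along_root _ _ seqV _ _ (SigSub (mem_set r0)) phi_cont erefl gE).
have HU : full_subcascade U.
  split=> // [v s Us [vs _]|v Uv /(Hsucc v Uv)[]//].
  exact: (down v s Us (croot_le v) vs).
exists U, HU, (f \o @subcascade_val V U HU); split.
  by apply: continuous_subcascade => x Ux nx; have [] := Hsucc x Ux nx.
have fE y : U y -> cext V y -> f y = g y.
  by move=> Uy [->|]; [rewrite fr -gE | exact: fmax].
by move=> x; rewrite -gE; exact: (fE _ (set_valP _) (cext_subcascade (set_valP x))).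
Qed.
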